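(* Let $G$ be a finite simple disconnected graph with no isolated vertices. Then the matching complex $M(G)$ is a connected graph if and only if $G$ has exactly two connected components, each of which is either a $K_3$ or a star graph.
   Context: A matching in $G$ is a set of edges no two of which share an endpoint. $M(G)$ is the simplicial complex whose faces are all matchings of $G$ (its vertices are the edges of $G$). ''$M(G)$ is a connected graph'' means that $M(G)$ has dimension at most one (no matching of size 3 exists in $G$) and is connected. The star graph $S_n$ ($n\ge1$) has $n+1$ vertices: one center joined to $n$ leaves. *)

(* Defs.v *)
From mathcomp Require Import all_boot all_order all_algebra.

Set Implicit Arguments.
Unset Strict Implicit.
Unset Printing Implicit Defensive.

Record sgraph := SGraph {
  vertex :> finType;
  adj : rel vertex;
  adj_sym : symmetric adj;
  adj_irrefl : irreflexive adj
}.

Definition components (G : sgraph) : {set {set G}} :=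
  equivalence_partition (connect (@adj G)) [set: G].

(* The graph without vertices has no component: it is not connected. *)
Definition connected (G : sgraph) : bool := #|components G| == 1.

Definition isolated (G : sgraph) (x : G) : bool := [forall y, ~~ adj x y].

Definition isomorphic (G H : sgraph) : Prop :=
  exists2 f : G -> H, bijective f & {mono f : x y / adj x y}.

Section Induced.
Variables (G : sgraph) (C : {set G}).

Definition induced_adj : rel {x | x \in C} := fun x y => adj (val x) (val y).

Lemma induced_sym : symmetric induced_adj.
Proof. by move=> x y; exact: adj_sym. Qed.

Lemma induced_irrefl : irreflexive induced_adj.
Proof. by move=> x; exact: adj_irrefl. Qed.

Definition induced : sgraph := SGraph induced_sym induced_irrefl.
End Induced.

Section Complete.
Variable n : nat.

Definition complete_adj : rel 'I_n := fun i j => i != j.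

Lemma complete_sym : symmetric complete_adj.
Proof. by move=> i j; rewrite /complete_adj eq_sym. Qed.

Lemma complete_irrefl : irreflexive complete_adj.
Proof. by move=> i; rewrite /complete_adj eqxx. Qed.

Definition complete_graph : sgraph := SGraph complete_sym complete_irrefl.
End Complete.

Section Star.
Variable n : nat.

(* The center is [None], the leaves are the [Some i]. *)
Definition star_adj : rel (option 'I_n) := fun x y => isSome x (+) isSome y.

Lemma star_sym : symmetric star_adj.
Proof. by move=> x y; exact: addbC. Qed.

Lemma star_irrefl : irreflexive star_adj.
Proof. by move=> x; exact: addbb. Qed.

Definition star_graph : sgraph := SGraph star_sym star_irrefl.
End Star.

Record scomplex := SComplex {
  svertex : finType;
  faces : {set {set svertex}};
  faces0 : set0 \in faces;
  faces1 : forall v, [set v] \in faces;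
  facesS : forall A B : {set svertex}, A \subset B -> B \in faces -> A \in faces
}.

Definition dim (K : scomplex) : int :=
  ((\max_(F in faces K) #|F|)%:Z - 1)%R.

Section Skeleton.
Variable K : scomplex.

Definition skeleton_adj : rel (svertex K) :=
  fun u v => (u != v) && ([set u; v] \in faces K).

Lemma skeleton_sym : symmetric skeleton_adj.
Proof. by move=> u v; rewrite /skeleton_adj eq_sym setUC. Qed.

Lemma skeleton_irrefl : irreflexive skeleton_adj.
Proof. by move=> u; rewrite /skeleton_adj eqxx. Qed.

Definition skeleton1 : sgraph := SGraph skeleton_sym skeleton_irrefl.
End Skeleton.

Definition is_connected_graph (K : scomplex) : Prop :=
  (dim K <= 1)%R /\ connected (skeleton1 K).

Section MatchingComplex.
Variable G : sgraph.

Definition edges : {set {set G}} :=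
  [set [set p.1; p.2] | p : G * G & adj p.1 p.2].

Definition edge : finType := {E : {set G} | E \in edges}.

Definition matching (F : {set edge}) : bool :=
  [forall E in F, forall E' in F, (E != E') ==> [disjoint val E & val E']].

Definition matchings : {set {set edge}} := [set F | matching F].

Lemma matchings0 : set0 \in matchings.
Proof. by rewrite inE; apply/forall_inP => E; rewrite inE. Qed.

Lemma matchings1 (E : edge) : [set E] \in matchings.
Proof.
rewrite inE; apply/forall_inP => A /set1P ->.
by apply/forall_inP => B /set1P ->; rewrite eqxx.
Qed.

Lemma matchingsS (A B : {set edge}) :
  A \subset B -> B \in matchings -> A \in matchings.
Proof.
move=> /subsetP sAB; rewrite !inE => /forall_inP mB.
apply/forall_inP => E /sAB /mB /forall_inP mE.
by apply/forall_inP => E' /sAB; exact: mE.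
Qed.

Definition matching_complex : scomplex :=
  SComplex matchings0 matchings1 matchingsS.
End MatchingComplex.

(* Main.v *)
(** The matching complex has dimension at most one iff G has no three pairwise
    disjoint edges. Each component carries an edge, so a disconnected G then has
    exactly two components, and the edges inside a component pairwise meet (two
    disjoint ones could be completed by an edge of the other component).
    Pairwise meeting edges either share a vertex, which makes the component a
    star, or form a triangle. Conversely, edges in different components are
    disjoint, hence adjacent in the 1-skeleton, so that any two edges are joined
    through an edge of the opposite component. *)
Require Import Defs.
From mathcomp Require Import all_boot all_order all_algebra.

Set Implicit Arguments.
Unset Strict Implicit.
Unset Printing Implicit Defensive.

(** * Connected components as a partition of the vertices *)

Section Components.
Variable G : sgraph.
Implicit Types (x y : G) (C D : {set G}) (E : edge G).

Lemma connect_adj_equivalence :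
  {in [set: G] & &, equivalence_rel (connect (@adj G))}.
Proof.
have symG := sym_connect_sym (@adj_sym G).
move=> x y z _ _ _; split=> [|cxy]; first exact: connect0.
by apply/idP/idP; apply: connect_trans => //; rewrite symG.
Qed.

Lemma components_partition : partition (components G) [set: G].
Proof. exact: equivalence_partitionP connect_adj_equivalence. Qed.

Lemma component_of_vertex x : exists2 C, C \in components G & x \in C.
Proof.
have /and3P[/eqP cov _ _] := components_partition.
have: x \in cover (components G) by rewrite cov inE.
by case/bigcupP=> C; exists C.
Qed.

Lemma componentsP C :
  reflect (exists x, C = [set y | connect (@adj G) x y]) (C \in components G).
Proof.
apply: (iffP imsetP) => [[x _ ->]|[x ->]]; exists x => //;
by apply/setP=> y; rewrite !inE.
Qed.

Lemma component_adj C x y :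
  C \in components G -> adj x y -> (x \in C) = (y \in C).
Proof.
case/componentsP=> z -> xy; rewrite !inE; apply/idP/idP => /connect_trans;
by apply; apply: connect1; rewrite // adj_sym.
Qed.

Lemma components_disjoint C D :
  C \in components G -> D \in components G -> C != D -> [disjoint C & D].
Proof.
by have /and3P[_ /trivIsetP tI _] := components_partition; apply: tI.
Qed.

Lemma components_gt0 x : 0 < #|components G|.
Proof.
by case: (component_of_vertex x) => C CG _; apply/card_gt0P; exists C.
Qed.

(** The component count is exactly one, so a component with a representative exists. Applied to the
    1-skeleton, this produces an edge of the graph and rules out the graph without vertices. *)
Lemma connected_vertex : connected G -> exists x : G, true.
Proof.
rewrite /connected => /eqP c1.
have /card_gt0P[C /componentsP[x _]] : 0 < #|components G| by rewrite c1.
by exists x.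
Qed.

Lemma connectedI x : (forall y, connect (@adj G) x y) -> connected G.
Proof.
move=> cx; apply/cards1P; exists [set: G]; apply/eqP.
rewrite eqEsubset sub1set; apply/andP; split.
  apply/subsetP=> C /componentsP[z ->]; rewrite inE; apply/eqP/setP=> y.
  rewrite !inE; apply: connect_trans (cx y).
  by rewrite (sym_connect_sym (@adj_sym G)).
by apply/componentsP; exists x; apply/setP=> y; rewrite !inE cx.
Qed.

(** * Edges, matchings and the dimension of the matching complex *)

Lemma edgeP E : exists x y, adj x y /\ val E = [set x; y].
Proof.
case/imsetP: (valP E) => -[x y]; rewrite inE /= => xy valE.
by exists x, y.
Qed.

Lemma edge_of_adj x y : adj x y -> exists E, val E = [set x; y].
Proof.
move=> xy; have Exy : [set x; y] \in edges G.
  by apply/imsetP; exists (x, y); rewrite ?inE.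
by exists (exist _ [set x; y] Exy : edge G).
Qed.

(** Edges are nonempty, so no edge is disjoint from itself. *)
Lemma disjoint_edge_neq E E' : [disjoint val E & val E'] -> E != E'.
Proof.
case: (edgeP E) => x [y [_ Exy]]; apply: contraTneq => <-.
by rewrite -setI_eq0 setIid; apply/set0Pn; exists x; rewrite Exy set21.
Qed.

Lemma component_of_edge E : exists2 C, C \in components G & val E \subset C.
Proof.
case: (edgeP E) => x [y [xy ->]]; have [C CG xC] := component_of_vertex x.
by exists C; rewrite // subUset !sub1set xC -(component_adj CG xy).
Qed.

(** A representative of the component has a neighbour, since no vertex is isolated, and adjacency
    does not leave the component. *)
Lemma edge_in_component C :
  (forall x : G, ~~ isolated x) -> C \in components G ->
  exists E, val E \subset C.
Proof.
move=> niG CG; case/componentsP: (CG) => x defC.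
have xC : x \in C by rewrite defC inE connect0.
have /forallPn[y /negPn xy] := niG x; have [E defE] := edge_of_adj xy.
by exists E; rewrite defE subUset !sub1set xC -(component_adj CG xy).
Qed.

Lemma component_disjoint_edges C D E E' :
  C \in components G -> D \in components G -> C != D ->
  val E \subset C -> val E' \subset D -> [disjoint val E & val E'].
Proof.
move=> CG DG neqCD EC ED; apply: disjointWl EC _; apply: disjointWr ED _.
exact: components_disjoint.
Qed.

Lemma matching2 E E' :
  [disjoint val E & val E'] -> [set E; E'] \in matchings G.
Proof.
move=> dEE'; rewrite inE; apply/forall_inP => A /set2P[]->;
  apply/forall_inP => B /set2P[]->; rewrite ?eqxx ?dEE' ?implybT //.
by rewrite disjoint_sym dEE' implybT.
Qed.

Lemma matching3 E1 E2 E3 :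
  [disjoint val E1 & val E2] -> [disjoint val E1 & val E3] ->
  [disjoint val E2 & val E3] -> [set E1; E2; E3] \in matchings G.
Proof.
move=> d12 d13 d23; rewrite inE.
have [d21 d31 d32] : [/\ [disjoint val E2 & val E1],
  [disjoint val E3 & val E1] & [disjoint val E3 & val E2]].
  by split; rewrite disjoint_sym.
apply/forall_inP => A; rewrite !inE -orbA => /or3P[]/eqP->;
  apply/forall_inP => B; rewrite !inE -orbA => /or3P[]/eqP->;
  by rewrite ?eqxx //; apply/implyP.
Qed.

Lemma dim_matching_complexP :
  (Defs.dim (matching_complex G) <= 1)%R <->
  (forall F : {set edge G}, F \in matchings G -> #|F| <= 2).
Proof.
rewrite /Defs.dim Num.Theory.lerBlDr.
(* The bound is now an inequality between nonnegative integers, convertible to a bound by 2 on the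
   maximum in [nat]. *)
split=> [le2 F FM|le2]; last exact/bigmax_leqP.
by move/bigmax_leqP: le2; apply.
Qed.

Lemma no_three_disjoint_edges E1 E2 E3 :
  (Defs.dim (matching_complex G) <= 1)%R ->
  [disjoint val E1 & val E2] -> [disjoint val E1 & val E3] ->
  [disjoint val E2 & val E3] -> False.
Proof.
move=> /dim_matching_complexP le2 d12 d13 d23.
have := le2 _ (matching3 d12 d13 d23).
rewrite setUC cardsU1 cards2 (disjoint_edge_neq d12) !inE.
by rewrite ![E3 == _]eq_sym (negPf (disjoint_edge_neq d13))
  (negPf (disjoint_edge_neq d23)).
Qed.

Definition intersecting C :=
  forall E E', val E \subset C -> val E' \subset C ->
  ~~ [disjoint val E & val E'].

(** Trades edges, which are sets, for their end points, so that they can be analysed by cases on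
    vertices and transported along isomorphisms. *)
Lemma intersectingP C :
  intersecting C <->
  {in C & &, forall x y z, {in C, forall t, adj x y -> adj z t ->
     [|| x == z, x == t, y == z | y == t]}}.
Proof.
split=> [iC x y z xC yC zC t tC xy zt | iC E E'].
  have [E defE] := edge_of_adj xy; have [E' defE'] := edge_of_adj zt.
  have := iC E E'; rewrite defE defE' !subUset !sub1set xC yC zC tC.
  move/(_ isT isT); apply: contraR; rewrite !negb_or => /and4P[xz xt yz yt].
  by rewrite disjoints_subset subUset !sub1set !inE !negb_or xz xt yz.
have [x [y [xy ->]]] := edgeP E; have [z [t [zt ->]]] := edgeP E'.
rewrite !subUset !sub1set => /andP[xC yC] /andP[zC tC].
have := iC x y z xC yC zC t tC xy zt; apply: contraL.
rewrite disjoints_subset subUset !sub1set !inE !negb_or.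
by case/andP=> /andP[-> ->] /andP[-> ->].
Qed.

End Components.

(** * Recognition of stars and complete graphs up to isomorphism *)

Lemma bij_option_ord (T : finType) (u : T) :
  exists2 f : T -> option 'I_(#|T|.-1),
    bijective f & forall x, isSome (f x) = (x != u).
Proof.
(* [unlift] sends the rank of [u] to [None] and closes the gap left among the other ranks;
   injectivity and equal cardinalities give bijectivity. *)
exists (fun x => unlift (enum_rank u) (enum_rank x)) => [|x].
  apply: inj_card_bij => [x y|].
    case: unliftP => [i|] eqx; case: unliftP => [j|] eqy //.
      by case=> eij; apply: enum_rank_inj; rewrite eqx eij.
    by move=> _; apply: enum_rank_inj; rewrite eqx.
  by rewrite card_option card_ord prednK //; apply/card_gt0P; exists u.
rewrite -(inj_eq enum_rank_inj); case: unliftP => [i ->|->]; last by rewrite eqxx.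
by rewrite eq_sym neq_lift.
Qed.

Lemma star_isomorphic (H : sgraph) (c : H) :
  (forall x y : H, adj x y = (x != c) (+) (y != c)) ->
  isomorphic H (star_graph #|H|.-1).
Proof.
move=> adjE; have [f bij_f fE] := bij_option_ord c.
by exists f => // x y; rewrite adjE /= /star_adj !fE.
Qed.

Lemma complete_isomorphic (H : sgraph) n :
  #|H| = n -> (forall x y : H, adj x y = (x != y)) ->
  isomorphic H (complete_graph n).
Proof.
move=> <- adjE; exists enum_rank => [|x y].
  exact: (Bijective (@enum_rankK _) (@enum_valK _)).
by rewrite adjE /= /complete_adj (inj_eq enum_rank_inj).
Qed.

(** * Components whose edges pairwise meet are triangles or stars, and conversely *)

Section ComponentShape.
Variables (G : sgraph) (C : {set G}).
Hypothesis G_no_isolated : forall x : G, ~~ isolated x.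
Hypothesis CG : C \in components G.

Lemma component_neighbour (x : G) :
  x \in C -> exists2 y, y \in C & adj x y.
Proof.
move=> xC; have /forallPn[y /negPn xy] := G_no_isolated x.
by exists y; rewrite // -(component_adj CG xy).
Qed.

(** A vertex of [C] other than [c] has a neighbour, and the covering condition forces that neighbour
    to be [c]; the same condition excludes edges between two such vertices. *)
Lemma star_component (c : G) : c \in C ->
  {in C &, forall x y, adj x y -> (x == c) || (y == c)} ->
  exists2 n, 1 <= n & isomorphic (induced C) (star_graph n).
Proof.
move=> cC cover_c; pose u : induced C := Sub c cC.
have adjE (x y : induced C) : adj x y = (x != u) (+) (y != u).
  have adj_c z : z \in C -> z != c -> adj z c.
    move=> zC zc; have [t tC zt] := component_neighbour zC.
    by have := cover_c _ _ zC tC zt; rewrite (negPf zc) => /eqP <-.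
  case: x y => x xC [y yC]; rewrite -!val_eqE /= /induced_adj /=.
  have [->|xc] := eqVneq x c; have [->|yc] := eqVneq y c => /=.
  - exact: adj_irrefl.
  - by rewrite adj_sym adj_c.
  - exact: adj_c.
  - by apply/negP=> /(cover_c _ _ xC yC); rewrite (negPf xc) (negPf yc).
exists #|induced C|.-1; last exact: star_isomorphic adjE.
(* A neighbour of [c] is a second vertex, so the star has at least one leaf. *)
have [y yC cy] := component_neighbour cC.
rewrite -subn1 subn_gt0; apply/card_gt1P.
exists u, (Sub y yC); split=> //; rewrite -val_eqE /=.
by apply: contraTneq cy => <-; rewrite adj_irrefl.
Qed.

(** A fourth vertex [v] would have a neighbour [w], and the edge [v w] could meet the three sides
    only in [w]; but no vertex lies on all three sides. *)
Lemma triangle_component (a b c : G) :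
  a \in C -> b \in C -> c \in C ->
  adj a b -> adj b c -> adj a c -> intersecting C ->
  isomorphic (induced C) (complete_graph 3).
Proof.
move=> aC bC cC ab bc ac /intersectingP iC.
have neq (x y : G) : adj x y -> x != y.
  by apply: contraTneq => ->; rewrite adj_irrefl.
have defC : C = [set a; b; c].
  apply/eqP; rewrite eqEsubset !subUset !sub1set aC bC cC !andbT.
  apply/subsetP=> v vC; rewrite !inE.
  have [w wC vw] := component_neighbour vC.
  have := iC _ _ _ vC wC aC _ bC vw ab; have := iC _ _ _ vC wC bC _ cC vw bc.
  have := iC _ _ _ vC wC aC _ cC vw ac.
  case: (eqVneq v a) => //= _; case: (eqVneq v b) => //= _.
  (* [w] is an end of [a c], then of [b c]: only [w = c] survives, and the side [a b] excludes
     it. *)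
  case: (eqVneq v c) => //= _ /orP[]/eqP-> /orP[]/eqP.
  - by move/eqP; rewrite (negPf (neq _ _ ab)).
  - by move/eqP; rewrite (negPf (neq _ _ ac)).
  - by move/eqP; rewrite eq_sym (negPf (neq _ _ bc)).
  - by move=> _; rewrite ![c == _]eq_sym (negPf (neq _ _ ac)) (negPf (neq _ _ bc)).
have cardC : #|C| = 3.
  by rewrite defC setUC cardsU1 cards2 !inE ![c == _]eq_sym !negb_or !neq.
apply: complete_isomorphic => [|[x xC] [y yC]].
  by rewrite card_sig -cardC; apply: eq_card.
rewrite -val_eqE /= /induced_adj /=.
move: xC yC; rewrite defC !inE -!orbA.
by move=> /or3P[]/eqP-> /or3P[]/eqP->; rewrite ?eqxx ?adj_irrefl // ?neq //
  adj_sym // eq_sym ?ab ?bc ?ac neq.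
Qed.

(** It suffices to test the two ends of one edge [a b]: if neither lies on all edges of [C], an edge
    avoiding [a] and an edge avoiding [b] complete a triangle. *)
Lemma intersecting_component : intersecting C ->
  isomorphic (induced C) (complete_graph 3) \/
  (exists2 n, 1 <= n & isomorphic (induced C) (star_graph n)).
Proof.
move=> iC; have /intersectingP meetC := iC.
have coverP (z : G) : {in C &, forall x y, adj x y -> (x == z) || (y == z)} \/
    exists x y, [/\ x \in C, y \in C, adj x y, x != z & y != z].
  case: (boolP [exists x in C, exists y in C, [&& adj x y, x != z & y != z]]).
    case/exists_inP=> x xC /exists_inP[y yC /and3P[xy xz yz]].
    by right; exists x, y.
  move/exists_inPn=> nE; left=> x y xC yC xy.
  have /exists_inPn/(_ y yC) := nE x xC.
  by rewrite xy /= -negb_or negbK.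
have [a [b [aC bC ab]]] : exists a b, [/\ a \in C, b \in C & adj a b].
  case/componentsP: (CG) => a defC.
  have aC : a \in C by rewrite defC inE connect0.
  by have [b bC ab] := component_neighbour aC; exists a, b.
have [star_a|[x [y [xC yC xy xa ya]]]] := coverP a.
  by right; apply: star_component star_a.
have [star_b|[z [t [zC tC zt zb tb]]]] := coverP b.
  by right; apply: star_component star_b.
(* The edge avoiding [a] is [b c], and the edge avoiding [b] is then [a c]. *)
have [c [cC bc ca]] : exists c, [/\ c \in C, adj b c & c != a].
  have := meetC _ _ _ aC bC xC _ yC ab xy.
  rewrite ![a == _]eq_sym (negPf xa) (negPf ya) /=.
  case/orP=> /eqP->; first by exists y.
  by exists x; rewrite adj_sym.
have ac : adj a c.
  have := meetC _ _ _ bC cC zC _ tC bc zt.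
  have := meetC _ _ _ aC bC zC _ tC ab zt.
  rewrite ![b == _]eq_sym (negPf zb) (negPf tb) /= orbF.
  (* The edge [z t] meets [a b] and [b c] outside [b], so it contains [a] and [c]; the two cases
     where both are the same end contradict [ca]. *)
  case/orP=> /eqP aE /orP[]/eqP cE.
  - by rewrite cE -aE eqxx in ca.
  - by rewrite cE aE.
  - by rewrite adj_sym cE aE.
  - by rewrite cE -aE eqxx in ca.
by left; apply: (@triangle_component a b c).
Qed.

(** An isomorphism preserves adjacency and reflects equality of vertices, so the claim is checked in
    the model: two edges among three vertices must overlap, and two edges of a star share the
    center. *)
Lemma shaped_component_intersecting :
  isomorphic (induced C) (complete_graph 3) \/
    (exists2 n, 1 <= n & isomorphic (induced C) (star_graph n)) ->
  intersecting C.
Proof.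
move=> shape; apply/intersectingP=> x y z xC yC zC t tC xy zt.
pose X : induced C := Sub x xC; pose Y : induced C := Sub y yC.
pose Z : induced C := Sub z zC; pose T : induced C := Sub t tC.
suff: [|| X == Z, X == T, Y == Z | Y == T] by rewrite -!val_eqE.
have {xy}XY : adj X Y by []. have {zt}ZT : adj Z T by [].
case: shape => [[f bij_f f_mono]|[n _ [f bij_f f_mono]]];
  rewrite -!(inj_eq (bij_inj bij_f)); move: XY ZT; rewrite -!f_mono /=.
  move: (f X) (f Y) (f Z) (f T).
  (* All quadruples of vertices of the triangle are enumerated. *)
  by do 4![case=> [[|[|[|?]]] ?] //].
by rewrite /star_adj; case: (f X) (f Y) (f Z) (f T) => [?|] [?|] [?|] [?|];
  rewrite ?eqxx ?orbT.
Qed.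

End ComponentShape.

(** * Dimension and connectedness of the matching complex in terms of components *)

Section MatchingComplexConnected.
Variable G : sgraph.
Hypothesis G_no_isolated : forall x : G, ~~ isolated x.

(** Edges chosen in three distinct components would form a matching of size three. *)
Lemma dim_le1_components_le2 :
  (Defs.dim (matching_complex G) <= 1)%R -> #|components G| <= 2.
Proof.
move=> dim1; rewrite leqNgt; apply/negP.
case/card_gt2P=> A [B [C [[AG BG CG] [AB BC CA]]]].
have [E1 E1A] := edge_in_component G_no_isolated AG.
have [E2 E2B] := edge_in_component G_no_isolated BG.
have [E3 E3C] := edge_in_component G_no_isolated CG.
apply: (@no_three_disjoint_edges _ E1 E2 E3 dim1).
- exact: component_disjoint_edges AB _ _.
- by apply: component_disjoint_edges E1A E3C; rewrite // eq_sym.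
- exact: component_disjoint_edges BC _ _.
Qed.

Lemma other_component (C : {set G}) :
  1 < #|components G| -> exists2 D, D \in components G & C != D.
Proof.
case/card_gt1P=> A [B [AG BG AB]].
by have [->|CA] := eqVneq C A; [exists B | exists A].
Qed.

Lemma dim_le1_intersecting (C : {set G}) :
  (Defs.dim (matching_complex G) <= 1)%R -> 1 < #|components G| ->
  C \in components G -> intersecting C.
Proof.
move=> dim1 c_gt1 CG E1 E2 E1C E2C; apply/negP=> d12.
have [D DG CD] := other_component C c_gt1.
have [E3 E3D] := edge_in_component G_no_isolated DG.
apply: (@no_three_disjoint_edges _ E1 E2 E3 dim1 d12).
- exact: component_disjoint_edges CD E1C E3D.
- exact: component_disjoint_edges CD E2C E3D.
Qed.

(** Sending each edge of [F] to its component is injective: distinct edges of a matching are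
    disjoint, while edges of one component meet. *)
Lemma intersecting_matching_le (F : {set edge G}) :
  {in components G, forall C, intersecting C} ->
  F \in matchings G -> #|F| <= #|components G|.
Proof.
move=> iG; rewrite inE => /forall_inP FM.
(* The default [set0] is never taken, since every edge lies in some component. *)
pose h (E : edge G) : {set G} :=
  odflt set0 [pick C in components G | val E \subset C].
have hP E : h E \in components G /\ val E \subset h E.
  rewrite /h; case: pickP => [C /andP[]//|noC].
  by have [C CG EC] := component_of_edge E; have := noC C; rewrite /= CG EC.
rewrite -(card_in_imset (f := h) (D := mem F)) => [|E E' EF E'F hEE'].
  by apply/subset_leq_card/subsetP=> _ /imsetP[E _ ->]; case: (hP E).
apply: contraTeq (FM E EF) => neqEE'.
rewrite negb_forall_in; apply/exists_inP; exists E' => //.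
have [hG Eh] := hP E; have [_ E'h] := hP E'; rewrite -hEE' in E'h.
by rewrite neqEE' (negPf (iG _ hG _ _ Eh E'h)).
Qed.

Lemma skeleton_connected :
  1 < #|components G| -> connected (skeleton1 (matching_complex G)).
Proof.
move=> c_gt1.
have adj_disjoint (E E' : edge G) : [disjoint val E & val E'] ->
    @adj (skeleton1 (matching_complex G)) E E'.
  by move=> d; rewrite /= /skeleton_adj (disjoint_edge_neq d) matching2.
have /card_gt0P[C CG] := ltnW c_gt1.
have [D DG CD] := other_component C c_gt1.
have [E EC] := edge_in_component G_no_isolated CG.
have [E' ED] := edge_in_component G_no_isolated DG.
apply: (@connectedI (skeleton1 (matching_complex G)) E) => A.
have [B BG AB] := component_of_edge A.
(* An edge [A] outside [C] is adjacent to [E]; one inside [C] is reached through [E'], which is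
   adjacent to both. *)
have [defB|CB] := eqVneq C B; last first.
  by apply/connect1/adj_disjoint/(component_disjoint_edges CG BG).
apply: (@connect_trans _ _ E'); apply/connect1/adj_disjoint.
  exact: component_disjoint_edges CD EC ED.
rewrite disjoint_sym; apply: component_disjoint_edges CD _ ED => //.
by rewrite defB.
Qed.

End MatchingComplexConnected.

Theorem lemma3p4 (G : sgraph)
    (G_disconnected : ~~ connected G)
    (G_no_isolated : forall x : G, ~~ isolated x) :
  is_connected_graph (matching_complex G) <->
  #|components G| = 2 /\
  (forall C : {set G}, C \in components G ->
     isomorphic (induced C) (complete_graph 3) \/
     (exists2 n : nat, 1 <= n & isomorphic (induced C) (star_graph n))).
Proof.
split=> [[dim1 /connected_vertex[E _]]|[c2 shape]].
  have [x [y _]] := edgeP E.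
  have c2 : #|components G| = 2.
    (* The dimension allows at most two components, disconnectedness excludes one, and the vertex
       [x] excludes zero. *)
    apply/eqP; rewrite eqn_leq dim_le1_components_le2 //= ltn_neqAle eq_sym.
    by rewrite G_disconnected (components_gt0 x).
  split=> // C CG; apply: intersecting_component => //.
  by apply: dim_le1_intersecting; rewrite ?c2.
split; last by apply: skeleton_connected; rewrite ?c2.
(* The bound 2 on the size of a matching is read as the number of components. *)
apply/dim_matching_complexP => F FM; rewrite -c2.
apply: intersecting_matching_le FM => C CG.
exact: shaped_component_intersecting (shape C CG).
Qed.
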